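(* For each $n\ge1$, there exists a Borel unlayered toast on $F(2^{\mathbb{Z}^n})$ (with respect to the Schreier graph of the shift action of $\mathbb{Z}^n$ with the standard generators).
   Context: $\mathbb{Z}^n$ acts on $2^{\mathbb{Z}^n}=\{0,1\}^{\mathbb{Z}^n}$ by $(g\cdot x)(h)=x(g+h)$, and $F(2^{\mathbb{Z}^n})=\{x:\forall g\in\mathbb{Z}^n\setminus\{0\},\ g\cdot x\ne x\}$. The Schreier graph $\Gamma$ on $X=F(2^{\mathbb{Z}^n})$ has edges $(x,s\cdot x)$ for $s\in\{\pm e_1,\dots,\pm e_n\}$. $\rho_\Gamma$ is the shortest-path metric on the connected components of $\Gamma$ (which are the orbits), and $E_\Gamma$ is the equivalence relation whose classes are these components. A sequence $\{T_n\}$, where each $T_n\subseteq E_\Gamma$ is an equivalence relation on a subset $\mathrm{dom}(T_n)$ of $X$, is an (unlayered) toast if: (1) each $T_n$-class is finite; (2) $\bigcup_n\mathrm{dom}(T_n)=X$; (3) for each $T_n$-class $C$ and each $T_m$-class $C'$ with $m>n$, if $C\cap C'\ne\varnothing$ then $C\subseteq C'$; (4) for each $T_n$-class $C$ there are $m>n$ and a $T_m$-class $C'$ with $C\subseteq C'\setminus\partial C'$, where $\partial C'=\{x\in C':\rho_\Gamma(x,X\setminus C')=1\}$. It is Borel if each $\mathrm{dom}(T_n)$ is Borel and each $T_n$ is a Borel equivalence relation on $\mathrm{dom}(T_n)$. *)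

(* Defs.v *)
From mathcomp Require Import all_boot all_order all_algebra.
From mathcomp Require Import all_classical all_reals all_analysis.

Set Implicit Arguments.
Unset Strict Implicit.
Unset Printing Implicit Defensive.

Import Order.TTheory GRing.Theory.
Local Open Scope classical_set_scope.

(* Borel subsets of the subspace [D] of [T], as subsets of [T]. *)
Definition borel_in (T : topologicalType) (D : set T) : set (set T) :=
  <<s D, [set D `&` U | U in open] >>.

Section Graph.
Variables (X : Type) (G : X -> X -> Prop).

(* [walk k x y]: there is a walk with [k] edges from [x] to [y]. *)
Fixpoint walk (k : nat) (x y : X) : Prop :=
  if k is k'.+1 then exists2 z, G x z & walk k' z y else x = y.

Definition graph_conn : set (X * X) := [set p | exists k, walk k p.1 p.2].

(* The least element of [A]; the default value [0] is only used for
   [A = set0], i.e. for distances that are infinite. *)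
Definition least (A : set nat) : nat := xget 0 (A `&` lbound A).

Definition graph_dist (x y : X) : nat := least [set k | walk k x y].

Definition graph_dist_set (x : X) (S : set X) : nat :=
  least [set graph_dist x y | y in S `&` [set y | graph_conn (x, y)]].

(* Since [1] is not the default value of [least], the distance to [~` C]
   being [1] implies that it is finite. *)
Definition boundary (C : set X) : set X :=
  [set x | C x /\ graph_dist_set x (~` C) = 1].

Definition rel_dom (T : set (X * X)) : set X := [set x | exists y, T (x, y)].

Definition equivalence_on (D : set X) (T : set (X * X)) : Prop :=
  [/\ T `<=` D `*` D,
      forall x, D x -> T (x, x),
      forall x y, T (x, y) -> T (y, x) &
      forall x y z, T (x, y) -> T (y, z) -> T (x, z)].

Definition is_class (T : set (X * X)) (C : set X) : Prop :=
  exists2 x, rel_dom T x & C = [set y | T (x, y)].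

Record unlayered_toast (T : nat -> set (X * X)) : Prop := UnlayeredToast {
  toast_conn : forall n, T n `<=` graph_conn;
  toast_equiv : forall n, equivalence_on (rel_dom (T n)) (T n);
  toast_finite : forall n C, is_class (T n) C -> finite_set C;
  toast_cover : \bigcup_n rel_dom (T n) = [set: X];
  toast_nested : forall n m C C', (n < m)%N ->
    is_class (T n) C -> is_class (T m) C' -> C `&` C' !=set0 -> C `<=` C';
  toast_interior : forall n C, is_class (T n) C ->
    exists m C', [/\ (n < m)%N, is_class (T m) C' & C `<=` C' `\` boundary C']
}.

End Graph.

Definition borel_toast (X : topologicalType) (T : nat -> set (X * X)) : Prop :=
  forall n, borel_in [set: X] (rel_dom (T n)) /\
            borel_in (rel_dom (T n) `*` rel_dom (T n)) (T n).

Section Shift.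
Local Open Scope ring_scope.
Variable n : nat.

(* [2 ^ Z^n] with the product topology of the discrete space [bool]. *)
Definition shift_space : topologicalType :=
  prod_topology (fun _ : 'rV[int]_n => bool).

Definition shift_act (g : 'rV[int]_n) (x : shift_space) : shift_space :=
  fun h => x (g + h).

Definition free_part : set shift_space :=
  [set x | forall g : 'rV[int]_n, g != 0 -> shift_act g x <> x].

Definition basis_vec (i : 'I_n) : 'rV[int]_n := delta_mx 0 i.

(* The vertices form the subtype [set_type free_part], which carries the
   subspace topology. *)
Definition schreier (x y : set_type free_part) : Prop :=
  exists i : 'I_n, set_val y = shift_act (basis_vec i) (set_val x) \/
                   set_val y = shift_act (- basis_vec i) (set_val x).

End Shift.

(* Main.v *)
(* At scale R, greedy choice of maximal 6R-separated Borel sets, each among the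
   points not yet R-covered by the previous ones, covers everything within
   12^n + 1 steps, since that many pairwise R-apart points do not fit in a ball
   of radius 6R.  With R = 6^k, every point is thus within R of the markers of
   some layer i <= 12^n at each scale k, hence for some i at infinitely many k;
   keeping for every orbit only the markers of the least such i yields
   6R-separated Borel center sets N k such that every point lies ever deeper
   inside balls of radius 2R around them.  These balls, each enlarged by the
   lower-level pieces that meet it, stay within radius 3R: they are the toast. *)

Require Import Defs.
From mathcomp Require Import all_boot all_order all_algebra.
From mathcomp Require Import all_classical all_reals all_analysis.
From mathcomp Require Import zify.

Set Implicit Arguments.
Unset Strict Implicit.
Unset Printing Implicit Defensive.

Import Order.TTheory GRing.Theory.
Local Open Scope classical_set_scope.

(** * Walks, connectedness and boundary points of a graph *)

Section Graph.
Variables (X : Type) (G : X -> X -> Prop).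

(** A nonzero value is not the default of [xget], so the minimum is attained. *)
Lemma leastP (A : set nat) : least A <> 0 -> A (least A).
Proof. by rewrite /least; case: xgetP => [k _ []|]. Qed.

Lemma walk_cat k l x y z : walk G k x y -> walk G l y z -> walk G (k + l) x z.
Proof.
elim: k x => [x /= ->|k IH x [u xu uy] yz] //=.
by exists u => //; exact: IH.
Qed.

Lemma graph_conn_trans x y z :
  graph_conn G (x, y) -> graph_conn G (y, z) -> graph_conn G (x, z).
Proof. by move=> [k xy] [l yz]; exists (k + l); exact: walk_cat xy yz. Qed.

(** Both minima equal 1, hence are attained: first by a point outside [C] at distance 1, then by a
    one-edge walk to it. *)
Lemma boundary_edge (C : set X) x :
  boundary G C x -> exists2 y, G x y & ~ C y.
Proof.
move=> [_ d1].
have [y [ny _] xy1] : [set graph_dist G x y |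
    y in ~` C `&` [set y | graph_conn G (x, y)]] 1.
  by rewrite -d1; apply: leastP; rewrite -/(graph_dist_set G x _) d1.
have [z xz zy] : walk G 1 x y.
  by rewrite -xy1; apply: (@leastP [set k | walk G k x y]);
    rewrite -/(graph_dist G x y) xy1.
by exists z => //; rewrite zy.
Qed.

End Graph.

(** * From separated, recurrently deep centers to a toast *)

Section CenterToast.
Variables (X : Type) (G : X -> X -> Prop) (near : nat -> X -> X -> Prop).
Hypothesis near_refl : forall r x, near r x x.
Hypothesis near_sym : forall r x y, near r x y -> near r y x.
Hypothesis near_trans : forall r s x y z,
  near r x y -> near s y z -> near (r + s) x z.
Hypothesis near_finite : forall r x, finite_set [set y | near r x y].
Hypothesis near_conn : forall r x y, near r x y -> graph_conn G (x, y).
Hypothesis edge_near : forall x y, G x y -> near 1 x y.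

Variable N : nat -> set X.

(** Enlarging sets and forming classes depend on each other; with [A] as an argument this is one
    structural recursion on the level. Only the classes meeting [A] itself are added, not those
    meeting the enlarged set, which keeps the growth bounded. *)
Fixpoint absorb (k : nat) (A : set X) : set X :=
  if k is j.+1 then
    let cls m := absorb j [set x | near (2 * 6 ^ j) m x] in
    absorb j A `|` \bigcup_(m in [set m | N j m /\ cls m `&` A !=set0]) cls m
  else A.

Definition cls k m : set X := absorb k [set x | near (2 * 6 ^ k) m x].

Lemma absorbP k A x : absorb k A x <->
  A x \/ exists j m, [/\ (j < k)%N, N j m, cls j m `&` A !=set0 & cls j m x].
Proof.
elim: k => [|k IH] /=; first by split=> [|[//|[j [m []]]]]; [left|].
split=> [[/IH[Ax|[j [m [jk Nm mA mx]]]]|[m [Nm mA] mx]]|[Ax|[j [m [jk Nm mA mx]]]]].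
- by left.
- by right; exists j, m; split=> //; exact: ltnW.
- by right; exists k, m; split.
- by left; apply/IH; left.
- move: jk; rewrite ltnS leq_eqVlt => /orP[/eqP jk|jk].
    by rewrite jk in Nm mA mx; right; exists m.
  by left; apply/IH; right; exists j, m.
Qed.

Lemma clsP k m x : cls k m x <-> near (2 * 6 ^ k) m x \/
  exists j m', [/\ (j < k)%N, N j m',
    exists2 z, cls j m' z & near (2 * 6 ^ k) m z & cls j m' x].
Proof.
rewrite /cls absorbP; split=> -[mx|[j [m' [jk Nm [z]]]]]; try by left.
- by move=> [m'z mz] m'x; right; exists j, m'; split=> //; exists z.
- by move=> m'z mz m'x; right; exists j, m'; split=> //; exists z.
Qed.

Lemma near_le r s x y : (r <= s)%N -> near r x y -> near s x y.
Proof. by move=> /subnKC <- xy; exact: near_trans xy (near_refl _ _). Qed.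

Lemma cls_ball k m x : near (2 * 6 ^ k) m x -> cls k m x.
Proof. by move=> mx; apply/clsP; left. Qed.

Lemma cls_self k m : cls k m m.
Proof. exact/cls_ball/near_refl. Qed.

(** An absorbed class of level [j < k] meets the ball of radius [2 * 6 ^ k], and any two of its
    points are within [6 * 6 ^ j <= 6 ^ k]; so it adds at most [6 ^ k] to the radius. *)
Lemma cls_near k m x : cls k m x -> near (3 * 6 ^ k) m x.
Proof.
elim/ltn_ind: k m x => k IH m x /clsP[|[j [m' [jk _ [z m'z mz] m'x]]]].
  by apply: near_le; lia.
have := near_trans (near_trans mz (near_sym (IH _ jk _ _ m'z))) (IH _ jk _ _ m'x).
apply: near_le.
have : (6 ^ j.+1 <= 6 ^ k)%N by rewrite leq_exp2l.
by rewrite expnS; lia.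
Qed.

Hypothesis N_sep : forall k m m',
  N k m -> N k m' -> near (6 ^ k.+1) m m' -> m = m'.
(** As [d] does not depend on the level, [x] has depth at least [6 ^ k - d] in a ball of radius
    [2 * 6 ^ k] for infinitely many [k]. *)
Hypothesis N_deep : forall x, exists d, forall j, exists2 k, (j <= k)%N &
  exists2 m, N k m & near (6 ^ k + d) m x.

(** Centers of intersecting classes of one level are within [3 * 6 ^ k + 3 * 6 ^ k = 6 ^ k.+1]. *)
Lemma cls_inj k m m' x : N k m -> N k m' -> cls k m x -> cls k m' x -> m = m'.
Proof.
move=> Nm Nm' /cls_near mx /cls_near/near_sym m'x; apply: N_sep Nm Nm' _.
by apply: near_le (near_trans mx m'x); rewrite expnS; lia.
Qed.

(** If [x] is in the ball around [m], the lower class meets that ball and is absorbed. Otherwise [x]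
    is in an absorbed class of some level [l]. By induction this class lies in the level [j] class,
    which then meets the ball too, or contains it, or, when [l = j], equals it. *)
Lemma cls_nested j k m' m x : (j < k)%N -> N j m' -> N k m ->
  cls j m' x -> cls k m x -> cls j m' `<=` cls k m.
Proof.
elim/ltn_ind: k j m' m x => k IH j m' m x jk Nm' Nm m'x mx y m'y.
have step z : cls j m' z -> near (2 * 6 ^ k) m z -> cls k m y.
  by move=> m'z mz; apply/clsP; right; exists j, m'; split=> //; exists z.
move/clsP: mx => [mx|[l [c [lk Nc [z cz mz] cx]]]]; first exact: step m'x mx.
have [lj|jl|lj] := ltngtP l j.
- by apply: step mz; exact: (IH j jk l c m' x).
- apply/clsP; right; exists l, c; split=> //; first by exists z.
  exact: (IH l lk j m' c x).
- rewrite lj in Nc cx cz.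
  have cm' := cls_inj Nc Nm' cx m'x.
  by apply: step mz; rewrite -cm'.
Qed.

Definition center_toast k : set (X * X) :=
  [set p | exists m, [/\ N k m, cls k m p.1 & cls k m p.2]].

Lemma center_toast_dom k x :
  rel_dom (center_toast k) x <-> exists2 m, N k m & cls k m x.
Proof.
by split=> [[y [m [Nm mx _]]]|[m Nm mx]]; [exists m | exists x; exists m].
Qed.

Lemma center_toast_class k C :
  is_class (center_toast k) C <-> exists2 m, N k m & C = cls k m.
Proof.
split=> [[x /center_toast_dom[m Nm mx] ->]|[m Nm ->]].
  exists m => //; apply/seteqP; split=> y /=; last by exists m.
  by move=> [m' [Nm' m'x m'y]]; rewrite (cls_inj Nm Nm' mx m'x).
exists m; first by apply/center_toast_dom; exists m => //; exact: cls_self.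
apply/seteqP; split=> y /=.
  by exists m; split=> //; exact: cls_self.
by move=> [m' [Nm' m'x m'y]]; rewrite (cls_inj Nm Nm' (cls_self _ _) m'x).
Qed.

Lemma center_toastP : unlayered_toast G center_toast.
Proof.
split.
- move=> k [x y] [m [_ /= /cls_near mx /cls_near my]].
  exact: near_conn (near_trans (near_sym mx) my).
- move=> k; split.
  + move=> [x y] [m [Nm /= mx my]].
    by split; apply/center_toast_dom; exists m.
  + by move=> x /center_toast_dom[m Nm mx]; exists m.
  + by move=> x y [m [Nm mx my]]; exists m.
  + move=> x y z [m [Nm mx my]] [m' [Nm' m'y m'z]]; exists m; split=> //.
    by rewrite (cls_inj Nm Nm' my m'y).
- move=> k C /center_toast_class[m _ ->].
  by apply: sub_finite_set (near_finite (3 * 6 ^ k) m) => x /cls_near.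
- apply/seteqP; split=> // x _; have [d /(_ d)[k dk [m Nm mx]]] := N_deep x.
  exists k => //; apply/center_toast_dom; exists m => //; apply: cls_ball.
  by apply: near_le mx; have := ltn_expl k (isT : 1 < 6)%N; lia.
- move=> j k _ _ jk /center_toast_class[m Nm ->] /center_toast_class[m' Nm' ->].
  by move=> [x [mx m'x]]; exact: (cls_nested jk Nm Nm' mx m'x).
- move=> k C /center_toast_class[m Nm ->].
  (* Since [6 ^ l > l], this bound yields [6 ^ l + d + 3 * 6 ^ k + 1 <= 2 * 6 ^ l]: the class and
     all its neighbours lie in the ball around [c]. *)
  have [d /(_ (k + d + 3 * 6 ^ k + 1)%N)[l kl [c Nc cm]]] := N_deep m.
  exists l, (cls l c); split; first by lia.
    by apply/center_toast_class; exists c.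
  have inC x y : cls k m x -> near 1 x y -> cls l c y.
    move=> /cls_near mx xy; apply: cls_ball.
    apply: near_le (near_trans (near_trans cm mx) xy).
    by have := ltn_expl l (isT : 1 < 6)%N; lia.
  move=> x mx; split; first exact: inC mx (near_refl _ _).
  by move=> bx; have [y xy] := boundary_edge bx; apply; apply: inC mx (edge_near xy).
Qed.

End CenterToast.

(** * Closure of sigma-algebras under connectives and countable quantifiers *)

Section SigmaAlgebra.
Variables (T : Type) (S : set (set T)).
Hypothesis S_sigma : sigma_algebra [set: T] S.

Lemma sigma_not (A : set T) : S A -> S [set x | ~ A x].
Proof. by case: S_sigma => _ SC _ /SC; rewrite setTD. Qed.

Lemma sigma_ex (I : countType) (A : I -> set T) :
  (forall i, S (A i)) -> S [set x | exists i, A i x].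
Proof.
case: S_sigma => S0 _ SU SA.
pose B k := if @unpickle I k is Some i then A i else set0.
suff -> : [set x | exists i, A i x] = \bigcup_k B k.
  by apply: SU => k; rewrite /B; case: unpickle.
apply/seteqP; split=> x /=.
  by move=> [i Aix]; exists (pickle i) => //; rewrite /B pickleK.
by move=> [k _]; rewrite /B; case: unpickle => // i Aix; exists i.
Qed.

Lemma sigma_all (I : countType) (A : I -> set T) :
  (forall i, S (A i)) -> S [set x | forall i, A i x].
Proof.
move=> SA.
suff -> : [set x | forall i, A i x] = [set x | ~ exists i, ~ A i x].
  by apply: sigma_not; apply: sigma_ex => i; exact: sigma_not.
apply/seteqP; split=> x /= Ax; first by move=> [i]; apply.
by move=> i; apply: contrapT => nA; apply: Ax; exists i.
Qed.

Lemma sigma_or (A B : set T) : S A -> S B -> S [set x | A x \/ B x].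
Proof.
move=> SA SB.
suff -> : [set x | A x \/ B x] = [set x | exists b : bool, (if b then A else B) x].
  by apply: sigma_ex => -[].
apply/seteqP; split=> x /=; last by move=> [[] ?]; [left|right].
by move=> [?|?]; [exists true|exists false].
Qed.

Lemma sigma_and (A B : set T) : S A -> S B -> S [set x | A x /\ B x].
Proof.
move=> SA SB.
suff -> : [set x | A x /\ B x] = [set x | forall b : bool, (if b then A else B) x].
  by apply: sigma_all => -[].
apply/seteqP; split=> x /=; first by move=> [Ax Bx] [].
by move=> AB; split; [exact: (AB true)|exact: (AB false)].
Qed.

Lemma sigma_cst (P : Prop) : S [set _ | P].
Proof.
case: S_sigma => S0 SC _.
have [HP|HP] := pselect P.
  suff -> : [set _ | P] = [set: T] `\` set0 by exact: SC.
  by rewrite setD0; apply/seteqP; split.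
suff -> : [set _ | P] = set0 :> set T by [].
by apply/seteqP; split=> x /=.
Qed.

Lemma sigma_imp (P : Prop) (A : set T) : S A -> S [set x | P -> A x].
Proof.
move=> SA; have [HP|HP] := pselect P.
  suff -> : [set x | P -> A x] = A by [].
  by apply/seteqP; split=> x //=; apply.
suff -> : [set x | P -> A x] = [set _ | True] by exact: sigma_cst.
by apply/seteqP; split=> x /=.
Qed.

End SigmaAlgebra.

(** * The sup norm on integer vectors and a packing bound *)

Section Norm.
Variable n : nat.
Implicit Types g h : 'rV[int]_n.

Definition normle (r : nat) g : bool := [forall i, (`|g 0%R i| <= r)%N].

Lemma normleP r g : reflect (forall i, (`|g 0%R i| <= r)%N) (normle r g).
Proof. exact: forallP. Qed.

Lemma normle0 r : normle r (0%R : 'rV[int]_n).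
Proof. by apply/normleP => i; rewrite mxE. Qed.

Lemma normleN r g : normle r g -> normle r (- g)%R.
Proof. by move=> /normleP gr; apply/normleP => i; rewrite mxE abszN. Qed.

Lemma normleD r s g h : normle r g -> normle s h -> normle (r + s) (g + h)%R.
Proof.
move=> /normleP gr /normleP hs; apply/normleP => i; rewrite mxE.
have leD (a b : int) : (`|a| <= r -> `|b| <= s -> `|(a + b)%R| <= r + s)%N by lia.
exact: leD.
Qed.

Lemma normle_finite r : finite_set [set g | normle r g].
Proof.
pose F (f : {ffun 'I_n -> 'I_(r + r).+1}) : 'rV[int]_n :=
  (\row_i ((f i)%:Z - r%:Z))%R.
apply: (@sub_finite_set _ _ (F @` [set: {ffun 'I_n -> 'I_(r + r).+1}])).
  move=> g /normleP gr; exists [ffun i => inord `|(g 0 i + r%:Z)%R|] => //.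
  have gE (a : int) : (`|a| <= r)%N ->
      ((inord `|(a + r%:Z)%R| : 'I_(r + r).+1)%:Z - r%:Z)%R = a.
    by move=> ar; rewrite inordK; lia.
  by apply/rowP => i; rewrite mxE ffunE gE.
exact/finite_image/finite_finset.
Qed.

(* The cube of radius [6 R] is cut into [12 ^ n] cubes of side [R + 1]. *)
Lemma cube_packing R (s : nat -> 'rV[int]_n) :
    (forall i, (i < (12 ^ n).+1)%N -> normle (6 * R) (s i)) ->
  exists i j, [/\ (i < j)%N, (j < (12 ^ n).+1)%N & normle R (s j - s i)%R].
Proof.
move=> sR.
pose F (i : 'I_(12 ^ n).+1) : {ffun 'I_n -> 'I_12} :=
  [ffun c => inord (`|(s i 0 c + (6 * R)%:Z)%R| %/ R.+1)].
have /injectivePn[i [j ij Fij]] : ~~ injectiveb F.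
  apply/negP => /injectiveP/leq_card.
  by rewrite card_ffun !card_ord ltnn.
(* Shifted coordinates lie in [[0, 12 R]], so their quotients by [R + 1] are below 12 and [inord]
   does not alter them; equal quotients mean a difference of at most [R]. *)
have cellP (a b : int) : (`|b| <= 6 * R)%N -> (`|a| <= 6 * R)%N ->
    \val (inord (`|(a + (6 * R)%:Z)%R| %/ R.+1) : 'I_12) =
    \val (inord (`|(b + (6 * R)%:Z)%R| %/ R.+1) : 'I_12) ->
    (`|(b - a)%R| <= R)%N.
  move=> bR aR; rewrite /= !inordK.
  - move=> ab; have := divn_eq `|(a + (6 * R)%:Z)%R| R.+1.
    have := divn_eq `|(b + (6 * R)%:Z)%R| R.+1; rewrite ab.
    have := ltn_pmod `|(a + (6 * R)%:Z)%R| (ltn0Sn R).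
    have := ltn_pmod `|(b + (6 * R)%:Z)%R| (ltn0Sn R).
    by set q := (_ %/ _)%N; set r := (_ %% _)%N; set r' := (_ %% _)%N; lia.
  - by rewrite ltn_divLR //; lia.
  - by rewrite ltn_divLR //; lia.
have Rij : normle R (s j - s i)%R.
  apply/normleP => c; rewrite !mxE.
  have := congr1 (fun f : {ffun 'I_n -> 'I_12} => val (f c)) Fij; rewrite !ffunE.
  have /normleP/(_ c) := sR i (ltn_ord i).
  have /normleP/(_ c) := sR j (ltn_ord j).
  exact: cellP.
have [lij|lji|/val_inj eij] := ltngtP i j.
- by exists i, j.
- by exists j, i; split=> //; rewrite -(opprB (s j)); exact: normleN.
- by rewrite eij eqxx in ij.
Qed.

End Norm.

(** * Measurable markers for free actions of integer vectors *)

Section Action.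
Variables (n : nat) (X : Type) (act : 'rV[int]_n -> X -> X).
Hypothesis act0 : forall x, act 0%R x = x.
Hypothesis actD : forall g h x, act g (act h x) = act (g + h)%R x.
Hypothesis act_free : forall g x, act g x = x -> g = 0%R.
Implicit Types g h : 'rV[int]_n.

Definition near r (x y : X) : Prop := exists2 g, normle r g & y = act g x.

Lemma near_refl r x : near r x x.
Proof. by exists 0%R; [exact: normle0 | rewrite act0]. Qed.

Lemma near_sym r x y : near r x y -> near r y x.
Proof.
move=> [g gr ->]; exists (- g)%R; first exact: normleN.
by rewrite actD addNr act0.
Qed.

Lemma near_trans r s x y z : near r x y -> near s y z -> near (r + s) x z.
Proof.
move=> [g gr ->] [h hs ->]; exists (h + g)%R; last by rewrite actD.
by rewrite addrC; exact: normleD.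
Qed.

Lemma near_finite r x : finite_set [set y | near r x y].
Proof.
apply: sub_finite_set (finite_image (act^~ x) (normle_finite n r)).
by move=> y [g gr ->]; exists g.
Qed.

Lemma act_inj x : injective (act^~ x).
Proof.
move=> g h /= gh; apply/eqP; rewrite -subr_eq0; apply/eqP.
by apply: (@act_free _ x); rewrite addrC -actD gh actD addNr act0.
Qed.

(** By freeness the vector moving [x] to [act g x] is unique, so the condition does not depend on
    [x]. *)
Lemma near_act r x g : near r x (act g x) <-> normle r g.
Proof. by split=> [[h hr gh]|gr]; [rewrite (act_inj gh) | exists g]. Qed.

Variable S : set (set X).
Hypothesis S_sigma : sigma_algebra [set: X] S.
Hypothesis S_act : forall g A, S A -> S [set x | A (act g x)].

Lemma sigma_near r (A : set X) : S A -> S [set x | exists2 y, A y & near r x y].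
Proof.
move=> SA.
suff -> : [set x | exists2 y, A y & near r x y] =
    [set x | exists g, normle r g /\ A (act g x)].
  apply: sigma_ex => // g; apply: sigma_and => //; first exact: sigma_cst.
  exact: S_act.
apply/seteqP; split=> x /= [].
  by move=> y Ay [g gr yE]; exists g; rewrite -yE.
by move=> g [gr Ag]; exists (act g x) => //; exists g.
Qed.

Hypothesis separated_cover : forall K, exists U : nat -> set X,
  [/\ forall j, S (U j), forall x, exists j, U j x &
      forall j x y, U j x -> U j y -> near K x y -> x = y].

(** Greedy choice along the cover: stage [j] adds the points of [A] in [U j] that are not within [K]
    of earlier choices. Points added together do not conflict, as [U j] is itself separated. *)
Lemma maximal_separated K (A : set X) : S A -> exists M : set X,
  [/\ S M, M `<=` A, forall x y, M x -> M y -> near K x y -> x = y &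
      forall x, A x -> exists2 y, M y & near K x y].
Proof.
move=> SA; have [U [SU Ucov Usep]] := separated_cover K.
pose fix H j : set X := if j is i.+1 then
  [set x | H i x \/ ((A x /\ U i x) /\ ~ exists2 y, H i y & near K x y)] else set0.
have SH j : S (H j).
  elim: j => [|j IH]; first by case: S_sigma.
  apply: sigma_or => //; apply: sigma_and => //; first exact: sigma_and.
  by apply: sigma_not => //; exact: sigma_near.
have Hle i j x : (i <= j)%N -> H i x -> H j x.
  by move/subnKC <-; elim: (j - i)%N => [|d IH] Hx; rewrite ?addn0 ?addnS //; left; exact: IH.
have Hsep j x y : H j x -> H j y -> near K x y -> x = y.
  elim: j x y => // j IH x y [Hx|[[_ Ux] nx]] [Hy|[[_ Uy] ny]] xy.
  - exact: IH.
  - by case: ny; exists x => //; exact: near_sym.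
  - by case: nx; exists y.
  - exact: (Usep j).
exists [set x | exists j, H j x]; split.
- exact: sigma_ex.
- by move=> x [j]; elim: j => // j IH [/IH//|[[]]].
- move=> x y [i Hx] [j Hy]; apply: (Hsep (maxn i j)).
    by apply: Hle Hx; exact: leq_maxl.
  by apply: Hle Hy; exact: leq_maxr.
- move=> x Ax; have [j Ux] := Ucov x.
  have [[y Hy xy]|nx] := pselect (exists2 y, H j y & near K x y).
    by exists y => //; exists j.
  by exists x; [exists j.+1; right | exact: near_refl].
Qed.

(** Layer [i] is a maximal [K]-separated subset of the points not within [R] of any earlier
    layer. *)
Lemma layered_markers R K : exists M : nat -> set X,
  [/\ forall i, S (M i),
      forall i x y, M i x -> M i y -> near K x y -> x = y,
      forall i j x y, (i < j)%N -> M i x -> M j y -> ~ near R x y &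
      forall i x, (exists2 j, (j < i)%N & exists2 y, M j y & near R x y) \/
                  exists2 y, M i y & near K x y].
Proof.
(* The premise [S A] sits under the existential so that [f] is total; its values outside [S] are
   arbitrary. *)
have /choice[f fP] : forall A, exists M, S A ->
  [/\ S M, M `<=` A, forall x y, M x -> M y -> near K x y -> x = y &
      forall x, A x -> exists2 y, M y & near K x y].
  move=> A; have [/(maximal_separated K)[M MP]|nSA] := pselect (S A).
    by exists M.
  by exists A.
pose fix A i : set X := if i is j.+1 then
  [set x | A j x /\ ~ exists2 y, f (A j) y & near R x y] else [set: X].
have SA i : S (A i).
  elim: i => [|i IH]; first exact: (sigma_cst S_sigma True).
  apply: sigma_and => //; apply: sigma_not => //; apply: sigma_near.
  by have [] := fP _ IH.
have AP i x : A i x <->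
    forall j, (j < i)%N -> ~ exists2 y, f (A j) y & near R x y.
  elim: i => [|i IH]; first by [].
  split=> [[/IH Ai fi] j|Ai].
    by rewrite ltnS leq_eqVlt => /orP[/eqP->|/Ai].
  split; last exact: Ai.
  by apply/IH => j ji; apply: Ai; exact: ltnW.
exists (fun i => f (A i)); split.
- by move=> i; have [] := fP _ (SA i).
- by move=> i; have [] := fP _ (SA i).
- move=> i j x y ij fx fy xy; have [_ sub _ _] := fP _ (SA j).
  have /AP/(_ i ij) := sub _ fy; apply; exists x => //; exact: near_sym.
- move=> i x; have [_ _ _ fmax] := fP _ (SA i).
  have [/fmax|nA] := pselect (A i x); first by right.
  left; apply: contrapT => nj; apply: nA; apply/AP => j ji fj.
  by apply: nj; exists j.
Qed.

(** If no layer [i <= 12 ^ n] had a marker within [R] of [x], maximality would give one within [6 R]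
    in each. Different layers are more than [R] apart, against [cube_packing]. *)
Lemma bounded_layered_markers R : exists M : nat -> set X,
  [/\ forall i, S (M i),
      forall i x y, M i x -> M i y -> near (6 * R) x y -> x = y &
      forall x, exists2 i, (i < (12 ^ n).+1)%N & exists2 y, M i y & near R x y].
Proof.
have [M [SM Msep Mlayer Mmax]] := layered_markers R (6 * R).
exists M; split=> // x; apply: contrapT => nx.
have /choice[s sP] : forall i, exists g, (i < (12 ^ n).+1)%N ->
    M i (act g x) /\ normle (6 * R) g.
  move=> i; have [iN|iN] := ltnP i (12 ^ n).+1; last by exists 0%R.
  have [[j ji xj]|[y My [g gR yE]]] := Mmax i x; last by exists g; rewrite -yE.
  by case: nx; exists j => //; exact: ltn_trans iN.
have [i [j [ij jN sR]]] := cube_packing (fun i iN => (sP i iN).2).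
apply: (Mlayer i j _ _ ij (sP i (ltn_trans ij jN)).1 (sP j jN).1).
by exists (s j - s i)%R => //; rewrite actD subrK.
Qed.

(* Uniformly many layers suffice at every scale, so each point is close, at
   infinitely many scales, to the markers of one fixed layer; the least such
   layer depends only on the orbit. *)
Lemma toast_centers : exists N : nat -> set X,
  [/\ forall k, S (N k),
      forall k x y, N k x -> N k y -> near (6 ^ k.+1) x y -> x = y &
      forall x, exists d, forall j, exists2 k, (j <= k)%N &
        exists2 m, N k m & near (6 ^ k + d) m x].
Proof.
have /choice[M MP] := fun k => bounded_layered_markers (6 ^ k).
(* The slack [d] may vary with the point, which makes [often i] invariant along orbits. *)
pose often i x := exists d, forall j, exists k, (j <= k)%N /\
  exists2 y, M k i y & near (6 ^ k + d) x y.
have often_near i r x y : near r x y -> often i x -> often i y.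
  move=> xy [d dP]; exists (r + d)%N => j; have [k [jk [z Mz xz]]] := dP j.
  exists k; split=> //; exists z => //.
  by rewrite addnCA; apply: near_trans xz; exact: near_sym.
have often_ex x : exists i, `[< often i x >].
  apply: contrapT => nx.
  have /choice[b bP] : forall i, exists j, forall k, (j <= k)%N ->
      ~ exists2 y, M k i y & near (6 ^ k) x y.
    move=> i; apply: contrapT => ni; apply: nx; exists i; apply/asboolP.
    exists 0%N => j; apply: contrapT => nj; apply: ni; exists j => k jk yP.
    by apply: nj; exists k; rewrite addn0.
  (* If every layer failed beyond some [b i], the scale [k] past all these bounds would leave [x]
     uncovered. *)
  pose k := \max_(i < (12 ^ n).+1) b i.
  have [_ _ /(_ x)[i iN]] := MP k; apply: bP.
  exact: (leq_bigmax (F := fun i : 'I_(12 ^ n).+1 => b i) (Ordinal iN)).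
(* Quantifying over ['I_i] keeps the condition a countable intersection. *)
pose first i x := often i x /\ forall j : 'I_i, ~ often j x.
have first_uniq i j r x y : near r x y -> first i x -> first j y -> i = j.
  move=> xy [ix mini] [jy minj]; have [ij|ji|//] := ltngtP i j.
    by case: (minj (Ordinal ij)); exact: often_near xy ix.
  by case: (mini (Ordinal ji)); exact: often_near (near_sym xy) jy.
exists (fun k => [set x | exists i, M k i x /\ first i x]); split.
- have Soften i : S (often i).
    apply: sigma_ex => // d; apply: sigma_all => // j; apply: sigma_ex => // k.
    apply: sigma_and; [by []|exact: sigma_cst|].
    by apply: sigma_near; have [] := MP k.
  move=> k; apply: sigma_ex => // i; apply: sigma_and => //; first by have [] := MP k.
  by apply: sigma_and => //; apply: sigma_all => // j; exact: sigma_not.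
- move=> k x y [i [Mx ix]] [j [My jy]] xy.
  rewrite -(first_uniq _ _ _ _ _ xy ix jy) in My.
  by have [_ Msep _] := MP k; apply: Msep Mx My _; rewrite -expnS.
- move=> x; case: (ex_minnP (often_ex x)) => i /asboolP ix mini.
  have [d dP] := ix; exists d => j; have [k [jk [y My xy]]] := dP j.
  exists k => //; exists y; last exact: near_sym.
  exists i; split=> //; split; first exact: often_near xy ix.
  move=> [l li] /= /(often_near _ _ _ _ (near_sym xy))/asboolP/mini.
  by rewrite leqNgt li.
Qed.

(** Induction on the level: in [clsP] the center and the meeting point are written as translates of
    [m], so the quantifiers range over vectors, a countable type. *)
Lemma sigma_cls (N : nat -> set X) k g : (forall k, S (N k)) ->
  S [set m | cls near N k m (act g m)].
Proof.
move=> SN; elim/ltn_ind: k g => k IH g.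
suff -> : [set m | cls near N k m (act g m)] =
  [set m | normle (2 * 6 ^ k) g \/ exists j : 'I_k, exists a b : 'rV[int]_n,
    N j (act a m) /\ (normle (2 * 6 ^ k) (b + a)%R /\
      (cls near N j (act a m) (act b (act a m)) /\
       cls near N j (act a m) (act (g - a)%R (act a m))))].
  apply: sigma_or => //; first exact: sigma_cst.
  apply: sigma_ex => // j; apply: sigma_ex => // a; apply: sigma_ex => // b.
  apply: sigma_and => //; first exact: S_act.
  apply: sigma_and => //; first exact: sigma_cst.
  apply: sigma_and => //.
    exact: (S_act a (IH j (ltn_ord j) b)).
  exact: (S_act a (IH j (ltn_ord j) (g - a)%R)).
apply/seteqP; split=> m /=; rewrite clsP near_act.
  move=> [|[j [m' [jk Nm' [z m'z [b bk zE]] m'g]]]]; first by left.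
  rewrite {z}zE in m'z; right; exists (Ordinal jk) => /=.
  (* The vector [h] leads from the meeting point to the center [m'], so [a = h + b] and the way back
     is [- h]. *)
  have [h _ m'E] := near_sym (cls_near near_refl near_sym near_trans m'z).
  exists (h + b)%R, (- h)%R; rewrite -actD -m'E; split=> //; split.
    by rewrite addKr.
  have -> : act (- h)%R m' = act b m by rewrite m'E actD addNr act0.
  have -> // : act (g - (h + b))%R m' = act g m.
  by rewrite m'E !actD; congr act; rewrite -addrA subrK.
move=> [|[[j jk] [a [b [/= Na [bak [cb cg]]]]]]]; first by left.
right; exists j, (act a m); split=> //.
  by exists (act b (act a m)) => //; rewrite actD; apply/near_act.
by rewrite actD subrK in cg.
Qed.

End Action.

(** * Preimages and traces of Borel sets *)

Lemma sigma_preimage (T U : Type) (f : T -> U) (S : set (set T)) (G : set (set U)) :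
    sigma_algebra [set: T] S -> (forall A, G A -> S (f @^-1` A)) ->
  forall A, <<s [set: U], G >> A -> S (f @^-1` A).
Proof.
move=> sS GS; apply: (@smallest_sub _ _ _ [set A | S (f @^-1` A)]) => //.
have [S0 SC SU] := sS; split=> /=.
- by rewrite preimage_set0.
- by move=> A /SC; rewrite !setTD preimage_setC.
- by move=> F SF; rewrite preimage_bigcup; exact: SU.
Qed.

Lemma borel_sigma (T : topologicalType) (D : set T) : sigma_algebra D (borel_in D).
Proof. exact: smallest_sigma_algebra. Qed.

Lemma open_borel (T : topologicalType) (U : set T) : open U -> borel_in [set: T] U.
Proof. by move=> oU; apply: sub_sigma_algebra; exists U => //; rewrite setTI. Qed.

(** The sets whose trace on [D] is Borel in [D] form a sigma-algebra containing the open sets. *)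
Lemma borel_in_sub (T : topologicalType) (D A : set T) :
  A `<=` D -> borel_in [set: T] A -> borel_in D A.
Proof.
move=> /setIidr AD BA; rewrite -AD.
have := @smallest_sub _ (sigma_algebra [set: T])
  [set setT `&` U | U in open] [set A | borel_in D (D `&` A)].
apply=> //; first split=> /=; have [S0 SC SU] := borel_sigma D.
- by rewrite setI0.
- move=> B /SC; rewrite setTD -setDE; congr borel_in.
  by rewrite setDIr setDv set0U.
- by move=> F BF; rewrite setI_bigcupr; exact: SU.
- move=> _ [U oU <-]; by rewrite setTI; apply: sub_sigma_algebra; exists U.
Qed.

(** * The shift action on the free part and its Schreier graph *)

Section FreePart.
Variable n : nat.
Local Notation X := (set_type (@free_part n)).
Implicit Types (g h : 'rV[int]_n) (x y : X).

(** The group is abelian, so a vector fixing a translate of [x] fixes [x]; evaluating at [k - g]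
    undoes the translation. *)
Lemma free_part_shift g (x : shift_space n) :
  free_part x -> free_part (shift_act g x).
Proof.
move=> fx h h0 gx; apply: (fx h h0); apply/funext => k.
have := congr1 (fun z : shift_space n => z (k - g)%R) gx.
rewrite /shift_act /=.
have -> : (g + (h + (k - g)) = h + k)%R by rewrite addrCA [(g + _)%R]addrC subrK.
by have -> : (g + (k - g) = k)%R by rewrite addrC subrK.
Qed.

Definition free_act g x : X :=
  exist _ (shift_act g (set_val x)) (mem_set (@free_part_shift g _ (set_valP x))).

Lemma free_actE g x h : set_val (free_act g x) h = set_val x (g + h)%R.
Proof. by []. Qed.

Lemma free_ext x y : (forall h, set_val x h = set_val y h) -> x = y.
Proof. by move=> xy; apply: val_inj; apply/funext. Qed.

Lemma free_act0 x : free_act 0%R x = x.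
Proof. by apply: free_ext => h; rewrite free_actE add0r. Qed.

Lemma free_actD g h x : free_act g (free_act h x) = free_act (g + h)%R x.
Proof. by apply: free_ext => k; rewrite !free_actE addrCA addrA. Qed.

Lemma free_act_free g x : free_act g x = x -> g = 0%R.
Proof.
move=> gx; apply: contrapT => /eqP g0.
exact: (set_valP x g g0 (congr1 set_val gx)).
Qed.

Lemma schreierE x y : schreier x y <->
  exists i : 'I_n, y = free_act (basis_vec i) x \/ y = free_act (- basis_vec i)%R x.
Proof.
by split=> -[i [xy|xy]]; exists i; rewrite ?xy; try (by [left|right]);
  [left|right]; exact: val_inj.
Qed.

Lemma schreier_near x y : schreier x y -> near free_act 1 x y.
Proof.
have b1 (i : 'I_n) : normle 1 (basis_vec i).
  by apply/normleP => j; rewrite mxE eqxx /=; case: eqP.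
move=> /schreierE[i [->|->]]; first by exists (basis_vec i).
by exists (- basis_vec i)%R => //; exact: normleN.
Qed.

(** The vectors that join every point to its translate are closed under sums and include the basis
    vectors and their opposites. *)
Lemma act_conn g x : graph_conn (@schreier n) (x, free_act g x).
Proof.
pose P g := forall x, graph_conn (@schreier n) (x, free_act g x).
have P0 : P 0%R by move=> y; exists 0; rewrite free_act0.
have PD a b : P a -> P b -> P (a + b)%R.
  move=> Pa Pb y; rewrite -free_actD; exact: graph_conn_trans (Pb _) (Pa _).
have P1 y z : schreier y z -> graph_conn (@schreier n) (y, z).
  by move=> yz; exists 1; exists z.
have PM k a : P a -> P (a *+ k)%R.
  by move=> Pa; elim: k => [|k IH]; rewrite ?mulr0n // mulrS; exact: PD.
suff : P g by apply.
rewrite (row_sum_delta g); elim/big_ind: _ => // i _.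
have [Pp Pn] : P (basis_vec i) /\ P (- basis_vec i)%R.
  by split=> y; apply/P1/schreierE; exists i; [left|right].
case: (g 0%R i) => k.
  by rewrite -natz scaler_nat; exact: PM.
by rewrite NegzE scaleNr -scalerN -natz scaler_nat; exact: PM.
Qed.

Lemma near_conn r x y : near free_act r x y -> graph_conn (@schreier n) (x, y).
Proof. by move=> [g _ ->]; exact: act_conn. Qed.

Definition cylinder h (b : bool) : set X := [set x | set_val x h = b].

(* Included in the Borel sets, and translation-invariant without appeal to
   continuity of the action. *)
Definition cylinder_sigma : set (set X) :=
  <<s [set: X], [set A | exists h b, A = cylinder h b] >>.

Lemma cylinder_sigmaP : sigma_algebra [set: X] cylinder_sigma.
Proof. exact: smallest_sigma_algebra. Qed.

Lemma sigma_cylinder h b : cylinder_sigma (cylinder h b).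
Proof. by apply: sub_sigma_algebra; exists h, b. Qed.

Lemma cylinder_sigma_act g (A : set X) :
  cylinder_sigma A -> cylinder_sigma [set x | A (free_act g x)].
Proof.
apply: (sigma_preimage cylinder_sigmaP) => _ [h [b ->]].
exact: (sigma_cylinder (g + h)%R b).
Qed.

Lemma open_cylinder h b : open (cylinder h b).
Proof.
have oc : open [set z : shift_space n | z h = b].
  apply: (@open_comp _ bool (fun z : shift_space n => z h) [set b]).
    by move=> z _; exact: (@proj_continuous _ (fun _ : 'rV[int]_n => bool) h).
  exact: discrete_open.
by exists [set z : shift_space n | z h = b].
Qed.

(** A piece is given by a finite pattern [s] containing, for each nonzero [g] of norm at most [K],
    opposite values at some [h] and [g + h]; then [x] and its [g]-translate cannot both match it.
    Freeness gives each point such a pattern, and patterns are countably many. *)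
Lemma free_separated_cover K : exists U : nat -> set X,
  [/\ forall j, cylinder_sigma (U j), forall x, exists j, U j x &
      forall j x y, U j x -> U j y -> near free_act K x y -> x = y].
Proof.
pose U (s : seq ('rV[int]_n * bool)) : set X := [set x |
  (forall p : 'rV[int]_n * bool, p \in s -> cylinder p.1 p.2 x) /\
  forall g, normle K g -> g != 0%R ->
    exists h b, (h, b) \in s /\ ((g + h)%R, ~~ b) \in s].
have SU s : cylinder_sigma (U s).
  apply: (sigma_and cylinder_sigmaP); last exact: (sigma_cst cylinder_sigmaP).
  apply: (sigma_all cylinder_sigmaP) => p; apply: (sigma_imp cylinder_sigmaP).
  exact: sigma_cylinder.
have Ucov x : exists s, U s x.
  have /choice[h hP] : forall g, exists h, g != 0%R ->
      set_val x (g + h)%R != set_val x h.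
    move=> g; have [->|g0] := eqVneq g 0%R; first by exists 0%R.
    apply: contrapT => nh; apply: (set_valP x g g0); apply/funext => h.
    by apply: contrapT => /eqP xh; apply: nh; exists h.
  have /finite_seqP[s sE] := normle_finite n K.
  pose v k := (k, set_val x k).
  exists ([seq v (h g) | g <- s] ++ [seq v (g + h g)%R | g <- s]); split.
    by move=> p; rewrite mem_cat => /orP[] /mapP[g _ ->].
  move=> g gK g0; exists (h g), (set_val x (h g)).
  have gs : g \in s by have : [set` s] g by rewrite -sE.
  split; first by rewrite mem_cat map_f.
  rewrite mem_cat; apply/orP; right; apply/mapP; exists g => //; rewrite /v.
  by congr pair; have := hP g g0; case: (set_val x (g + h g)%R); case: set_val.
have Usep s x y : U s x -> U s y -> near free_act K x y -> x = y.
  move=> [xs sK] [ys _] [g gK yE].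
  have [g0|g0] := eqVneq g 0%R; first by rewrite yE g0 free_act0.
  have [h [b [/ys hb /xs ghb]]] := sK g gK g0.
  move: hb ghb; rewrite yE /cylinder /= free_actE => -> .
  by case: b.
exists (fun j => if @unpickle (seq ('rV[int]_n * bool)) j is Some s then U s else set0).
split.
- by move=> j; case: unpickle => //; case: cylinder_sigmaP.
- by move=> x; have [s Us] := Ucov x; exists (pickle s); rewrite pickleK.
- by move=> j x y; case: unpickle => // s; exact: Usep.
Qed.

(** * Borelness in the subspace and in its square *)

Lemma cylinder_sigma_borel (A : set X) : cylinder_sigma A -> borel_in [set: X] A.
Proof.
apply: (sigma_preimage (f := id) (borel_sigma _)) => _ [h [b ->]].
exact: (open_borel (open_cylinder h b)).
Qed.

Lemma cylinder_sigma_fst (A : set X) : cylinder_sigma A ->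
  borel_in [set: X * X] (fst @^-1` A).
Proof.
apply: (sigma_preimage (borel_sigma _)) => _ [h [b ->]]; apply: open_borel.
by apply: open_comp (open_cylinder h b) => p _; exact: cvg_fst.
Qed.

Lemma cylinder_sigma_snd (A : set X) : cylinder_sigma A ->
  borel_in [set: X * X] (snd @^-1` A).
Proof.
apply: (sigma_preimage (borel_sigma _)) => _ [h [b ->]]; apply: open_borel.
by apply: open_comp (open_cylinder h b) => p _; exact: cvg_snd.
Qed.

(** Equality is tested coordinate by coordinate, and there are countably many coordinates. *)
Lemma borel_act_graph g : borel_in [set: X * X] [set p | p.2 = free_act g p.1].
Proof.
have sB := borel_sigma [set: X * X].
suff -> : [set p | p.2 = free_act g p.1] = [set p : X * X | forall h, exists b,
    cylinder (g + h)%R b p.1 /\ cylinder h b p.2].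
  apply: (sigma_all sB) => h; apply: (sigma_ex sB) => b.
  apply: (sigma_and sB).
    exact: (cylinder_sigma_fst (sigma_cylinder _ _)).
  exact: (cylinder_sigma_snd (sigma_cylinder _ _)).
apply/seteqP; split=> -[x y] /=.
  by move=> -> h; exists (set_val x (g + h)%R).
move=> xy; apply: free_ext => h; rewrite free_actE.
by have [b [-> ->]] := xy h.
Qed.

Lemma borel_center_toast (N : nat -> set X) :
  (forall k, cylinder_sigma (N k)) -> borel_toast (center_toast (near free_act) N).
Proof.
move=> SN k.
have Scls g := sigma_cls free_act0 free_actD free_act_free cylinder_sigmaP
  cylinder_sigma_act k g SN.
have sB := borel_sigma [set: X * X].
have near_act x m : cls (near free_act) N k m x -> exists g, m = free_act g x.
  move=> /(cls_near (near_refl free_act0) (near_sym free_act0 free_actD)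
    (near_trans free_actD)).
  by move=> /(near_sym free_act0 free_actD)[g _]; exists g.
split.
  apply: cylinder_sigma_borel.
  suff -> : rel_dom (center_toast (near free_act) N k) = [set x | exists g,
      N k (free_act g x) /\
      cls (near free_act) N k (free_act g x) (free_act (- g)%R (free_act g x))].
    apply: (sigma_ex cylinder_sigmaP) => g; apply: (sigma_and cylinder_sigmaP).
      exact: cylinder_sigma_act.
    exact: (cylinder_sigma_act g (Scls (- g)%R)).
  apply/seteqP; split=> x /=.
    move=> /center_toast_dom[m Nm mx]; have [g mE] := near_act _ _ mx.
    by exists g; rewrite free_actD addNr free_act0 -mE.
  move=> [g []]; rewrite free_actD addNr free_act0 => Ng gx.
  by apply/center_toast_dom; exists (free_act g x).
apply: borel_in_sub.
  by move=> [x y] [m [Nm mx my]]; split; apply/center_toast_dom; exists m.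
(* Once [y] is the [h]-translate of [x], everything else concerns [x] alone: [g] leads to the
   center, and [- g] and [h - g] lead from it to [x] and [y]. *)
suff -> : center_toast (near free_act) N k = [set p | exists g h,
    p.2 = free_act h p.1 /\ (N k (free_act g p.1) /\
    (cls (near free_act) N k (free_act g p.1) (free_act (- g)%R (free_act g p.1)) /\
     cls (near free_act) N k (free_act g p.1) (free_act (h - g)%R (free_act g p.1))))].
  apply: (sigma_ex sB) => g; apply: (sigma_ex sB) => h.
  apply: (sigma_and sB); first exact: borel_act_graph.
  apply: (sigma_and sB); first exact: (cylinder_sigma_fst (cylinder_sigma_act g (SN k))).
  apply: (sigma_and sB).
    exact: (cylinder_sigma_fst (cylinder_sigma_act g (Scls (- g)%R))).
  exact: (cylinder_sigma_fst (cylinder_sigma_act g (Scls (h - g)%R))).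
apply/seteqP; split=> -[x y] /=.
  move=> [m [Nm /= mx my]]; have [g mE] := near_act _ _ mx.
  have [h mE'] := near_act _ _ my.
  have yE : y = free_act (g - h)%R x.
    by rewrite addrC -free_actD -mE mE' free_actD addNr free_act0.
  by exists g, (g - h)%R; rewrite !free_actD addNr free_act0 subrK -mE -yE.
move=> [g [h [yE [Ng []]]]]; rewrite !free_actD addNr free_act0 subrK -yE => gx gy.
by exists (free_act g x).
Qed.

End FreePart.

Theorem corollary4p13 (n : nat) (hn : (1 <= n)%N) :
  exists T : nat -> set (set_type (@free_part n) * set_type (@free_part n)),
    unlayered_toast (@schreier n) T /\ borel_toast T.
Proof.
have a0 := @free_act0 n; have aD := @free_actD n.
have [N [SN Nsep Ndeep]] := toast_centers a0 aD (@cylinder_sigmaP n)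
  (@cylinder_sigma_act n) (@free_separated_cover n).
exists (center_toast (near (@free_act n)) N); split; last exact: borel_center_toast.
apply: center_toastP => //.
- exact: near_refl.
- exact: near_sym.
- exact: near_trans.
- exact: near_finite.
- exact: near_conn.
- exact: schreier_near.
Qed.
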